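(* For $n\ge 3$, the $n$-cycle $C_n$ admits an adapted complex structure if and only if $n=3$ or $n=4$.
   Context: $C_n$ is the graph consisting of a single cycle with $n$ vertices. For a finite simple graph $\mathcal{G}=(V,E)$ label $V=\{v_1,\dots,v_n\}$ and write $e_{i,j}$ ($i<j$) for the edge joining $v_i$ and $v_j$, if it exists. The Lie algebra $\mathfrak{n}_{\mathcal{G}}$ is the real vector space with basis $V\cup E$ and Lie bracket $[v_i,v_j]=e_{i,j}$ for $i<j$ if $v_i,v_j$ are adjacent, $[v_i,v_j]=0$ if they are not adjacent, and all elements of $E$ central. A complex structure on a real Lie algebra $\mathfrak{g}$ is a linear map $J:\mathfrak{g}\to\mathfrak{g}$ with $J^2=-\mathrm{Id}$ and $[x,y]+J([Jx,y]+[x,Jy])-[Jx,Jy]=0$ for all $x,y\in\mathfrak{g}$. The graph $\mathcal{G}$ admits an adapted complex structure if there is a complex structure $J$ on $\mathfrak{n}_{\mathcal{G}}$ such that for every $x\in V\cup E$ either $Jx\in V\cup E$ or $-Jx\in V\cup E$. *)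

(* Defs.v *)
From HB Require Import structures.
From mathcomp Require Import all_boot all_order all_algebra.
From mathcomp Require Import reals.
From mathcomp Require Import ring.

Set Implicit Arguments.
Unset Strict Implicit.
Unset Printing Implicit Defensive.

Import Order.TTheory GRing.Theory Num.Theory.
Local Open Scope ring_scope.

HB.mixin Record Lmodule_isLieAlgebra (R : comNzRingType) L
    of GRing.Lmodule R L := {
  lie : L -> L -> L;
  lie_linear_l : forall (a : R) (x y z : L),
    lie (a *: x + y) z = a *: lie x z + lie y z;
  lie_linear_r : forall (a : R) (x y z : L),
    lie z (a *: x + y) = a *: lie z x + lie z y;
  liexx : forall x : L, lie x x = 0;
  lie_jacobi : forall x y z : L,
    lie x (lie y z) + lie y (lie z x) + lie z (lie x y) = 0
}.

#[short(type="lieAlgType")]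
HB.structure Definition LieAlgebra (R : comNzRingType) :=
  { L of GRing.Lmodule R L & Lmodule_isLieAlgebra R L }.

Definition complex_structure (R : realType) (L : lieAlgType R)
    (J : {linear L -> L}) : Prop :=
  (forall x : L, J (J x) = - x) /\
  (forall x y : L,
     lie x y + J (lie (J x) y + lie x (J y)) - lie (J x) (J y) = 0).

(* A finite simple graph, whose vertices are labelled by 'I_n. *)
Record sgraph (n : nat) := SGraph {
  adj :> rel 'I_n;
  adj_sym : symmetric adj;
  adj_irr : irreflexive adj
}.

(* The pair (i, j), with i < j, stands for the edge e_{i,j}. *)
Definition edge n (G : sgraph n) : Type :=
  {p : 'I_n * 'I_n | (p.1 < p.2)%N && G p.1 p.2}.

HB.instance Definition _ n (G : sgraph n) := Finite.on (edge G).

(* The free real vector space on V u E: an element is the family of its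
   coordinates. *)
Definition nlie (R : realType) n (G : sgraph n) : Type :=
  {ffun ('I_n + edge G)%type -> R^o}.

HB.instance Definition _ (R : realType) n (G : sgraph n) :=
  GRing.Lmodule.on (nlie R G).

(* nbasis and nbracket are locked because unification otherwise unfolds the
   underlying finite functions, which can diverge. *)
HB.lock Definition nbasis (R : realType) n (G : sgraph n)
    (b : 'I_n + edge G) : nlie R G :=
  [ffun c => (c == b)%:R].

(* The bilinear extension of [v_i, v_j] = e_{i,j} = - [v_j, v_i], in
   coordinates; lie_adj, lie_nadj, lie_edgel and lie_edger below recover the
   values on the basis. *)
HB.lock Definition nbracket (R : realType) n (G : sgraph n)
    (x y : nlie R G) : nlie R G :=
  [ffun c => match c with
             | inl _ => 0
             | inr e => x (inl (val e).1) * y (inl (val e).2)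
                        - x (inl (val e).2) * y (inl (val e).1)
             end].

Section GraphLieAlgebra.
Variables (R : realType) (n : nat) (G : sgraph n).
Implicit Types (x y z : nlie R G) (i j : 'I_n) (e : edge G).

Lemma nbasisE (b c : 'I_n + edge G) : nbasis R b c = (c == b)%:R.
Proof. by rewrite nbasis.unlock ffunE. Qed.

Lemma nbracket_inl x y i : nbracket x y (inl i) = 0.
Proof. by rewrite nbracket.unlock ffunE. Qed.

Lemma nbracket_inr x y e :
  nbracket x y (inr e) = x (inl (val e).1) * y (inl (val e).2)
                         - x (inl (val e).2) * y (inl (val e).1).
Proof. by rewrite nbracket.unlock ffunE. Qed.

Let nbE := (nbracket_inl, nbracket_inr).

Fact nbracket_linear_l (a : R) x y z :
  nbracket (a *: x + y) z = a *: nbracket x z + nbracket y z.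
Proof.
apply/ffunP=> -[i|e]; rewrite !(ffunE, nbE) ?scaler0 ?addr0 //.
by rewrite /GRing.scale /=; ring.
Qed.

Fact nbracket_linear_r (a : R) x y z :
  nbracket z (a *: x + y) = a *: nbracket z x + nbracket z y.
Proof.
apply/ffunP=> -[i|e]; rewrite !(ffunE, nbE) ?scaler0 ?addr0 //.
by rewrite /GRing.scale /=; ring.
Qed.

Fact nbracketxx x : nbracket x x = 0.
Proof. by apply/ffunP=> -[i|e]; rewrite !(ffunE, nbE) // mulrC subrr. Qed.

Fact nbracket_jacobi x y z :
  nbracket x (nbracket y z) + nbracket y (nbracket z x)
    + nbracket z (nbracket x y) = 0.
Proof.
by apply/ffunP=> -[i|e]; rewrite !(ffunE, nbE) ?mulr0 ?subrr ?addr0.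
Qed.

HB.instance Definition _ := Lmodule_isLieAlgebra.Build R (nlie R G)
  nbracket_linear_l nbracket_linear_r nbracketxx nbracket_jacobi.

Lemma lieE x y : lie x y = nbracket x y.
Proof. by []. Qed.

Let indB (P Q : bool) : P%:R * Q%:R = (P && Q)%:R :> R.
Proof. by case: P; rewrite ?mul1r ?mul0r. Qed.

Let inlE i j : (inl i == inl j :> 'I_n + edge G) = (i == j).
Proof. by []. Qed.

Lemma lie_adj i j (ij : (i < j)%N && G i j) :
  lie (nbasis R (inl i)) (nbasis R (inl j))
    = nbasis R (inr (exist _ (i, j) ij)).
Proof.
rewrite lieE; apply/ffunP=> -[k|f]; rewrite nbE !nbasisE // !inlE !indB.
have -> : (inr f == inr (exist _ (i, j) ij) :> 'I_n + edge G)
    = (val f == (i, j)) by [].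
case: f => -[k l] /= /andP[ltkl _]; have /andP[ltij _] := ij.
rewrite xpair_eqE; case: (altP (l =P i)) => [eli|_]; last by rewrite subr0.
case: (altP (k =P j)) => [ekj|_]; last by rewrite subr0.
by move: ltkl; rewrite eli ekj ltnNge ltnW.
Qed.

Lemma lie_nadj i j : ~~ G i j ->
  lie (nbasis R (inl i)) (nbasis R (inl j)) = 0 :> nlie R G.
Proof.
move=> nij; rewrite lieE; apply/ffunP=> -[k|f]; rewrite nbE ffunE //.
rewrite !nbasisE !inlE !indB; case: f => -[k l] /= /andP[_ Gkl].
have -> : (k == i) && (l == j) = false.
  by apply: contraNF nij => /andP[/eqP <- /eqP <-].
have -> : (l == i) && (k == j) = false.
  by apply: contraNF nij => /andP[/eqP <- /eqP <-]; rewrite adj_sym.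
exact: subrr.
Qed.

Lemma lie_edgel e x : lie (nbasis R (inr e)) x = 0.
Proof.
rewrite lieE; apply/ffunP=> -[k|f]; rewrite nbE ffunE //.
by rewrite !nbasisE !mul0r subrr.
Qed.

Lemma lie_edger e x : lie x (nbasis R (inr e)) = 0.
Proof.
rewrite lieE; apply/ffunP=> -[k|f]; rewrite nbE ffunE //.
by rewrite !nbasisE !mulr0 subrr.
Qed.

End GraphLieAlgebra.

Definition in_VE (R : realType) n (G : sgraph n) (x : nlie R G) : Prop :=
  exists b : 'I_n + edge G, x = nbasis R b.

Definition admits_adapted_complex_structure (R : realType) n
    (G : sgraph n) : Prop :=
  exists J : {linear nlie R G -> nlie R G},
    complex_structure J /\
    (forall x : nlie R G, in_VE x -> in_VE (J x) \/ in_VE (- J x)).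

Section Cycle.
Variable n : nat.

(* ordS is the cyclic successor i |-> i + 1 mod n; the condition i != j only
   matters for n = 1, where it excludes the loop. *)
Definition cycle_adj : rel 'I_n :=
  [rel i j | (i != j) && ((j == ordS i) || (i == ordS j))].

Fact cycle_adj_sym : symmetric cycle_adj.
Proof. by move=> i j; rewrite /cycle_adj /= eq_sym orbC. Qed.

Fact cycle_adj_irr : irreflexive cycle_adj.
Proof. by move=> i; rewrite /cycle_adj /= eqxx. Qed.

Definition cycle_graph : sgraph n := SGraph cycle_adj_sym cycle_adj_irr.

End Cycle.

(* Main.v *)
(** An adapted J pairs up the vertices and edges.  Integrability on an edge
    {u, v} forces u and v to be paired together, or one of them to be paired
    with a vertex adjacent to the other.  On the cycle with n >= 5, this means
    that for consecutive j, j+1, j+2, j+3 one of the pairs {j+1, j+2},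
    {j+1, j+3}, {j, j+2} occurs; the first never does, since it would exclude
    all three options for j+1, and then among any two consecutive
    vertices one lies between paired neighbours.  But {j, j+2} and {j+2, j+4}
    cannot both be pairs when n >= 5. *)

Require Import Defs.
From HB Require Import structures.
From mathcomp Require Import all_boot all_order all_algebra.
From mathcomp Require Import reals ring.

Set Implicit Arguments.
Unset Strict Implicit.
Unset Printing Implicit Defensive.

Import GRing.Theory Num.Theory.

(** * Signed permutations of the basis as adapted structures *)

Section SignedPermutation.
Local Open Scope ring_scope.
Variables (R : realType) (n : nat) (G : sgraph n).
Variables (d : 'I_n + edge G -> bool) (s : 'I_n + edge G -> 'I_n + edge G).
Implicit Types (x y : nlie R G) (b c : 'I_n + edge G).

(** Coordinates are pulled back along [s], so for an involution [s] the sign attached to the image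
    of a basis element [b] is read at [s b]. *)
Definition signed_perm x : nlie R G := [ffun c => (-1) ^+ d c * x (s c)].

Lemma signed_permE x c : signed_perm x c = (-1) ^+ d c * x (s c).
Proof. by rewrite /signed_perm ffunE. Qed.

Fact signed_perm_linear : linear signed_perm.
Proof.
move=> a x y; apply/ffunP=> c; rewrite !(ffunE, signed_permE).
by rewrite /GRing.scale /=; ring.
Qed.

HB.instance Definition _ :=
  GRing.isLinear.Build R (nlie R G) (nlie R G) *:%R signed_perm
    signed_perm_linear.

Hypotheses (sK : involutive s) (ds : forall c, d (s c) = ~~ d c).

(** Applying the map twice multiplies the signs at [c] and [s c], which [ds] makes opposite. *)
Lemma signed_permN x : signed_perm (signed_perm x) = - x.
Proof.
apply/ffunP=> c; rewrite !signed_permE sK ds ffunE mulrA -signr_addb.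
by rewrite addbN addbb expr1 mulN1r.
Qed.

Lemma signed_perm_basis b :
  signed_perm (nbasis R b) = (-1) ^+ d (s b) *: nbasis R (s b).
Proof.
apply/ffunP=> c; rewrite signed_permE ffunE !nbasisE /GRing.scale /=.
rewrite (can2_eq sK sK); case: (c =P s b) => [->|_] //.
by rewrite !mulr0.
Qed.

Lemma signed_perm_adapted :
  (forall x y, lie x y
     + signed_perm (lie (signed_perm x) y + lie x (signed_perm y))
     - lie (signed_perm x) (signed_perm y) = 0) ->
  admits_adapted_complex_structure R G.
Proof.
move=> integrable; exists (signed_perm : {linear nlie R G -> nlie R G}).
split; first by split; [exact: signed_permN | exact: integrable].
move=> _ [b ->]; rewrite /= signed_perm_basis.
case: (d (s b)); rewrite ?expr1 ?expr0 ?scaleN1r ?scale1r ?opprK.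
  by right; exists (s b).
by left; exists (s b).
Qed.

End SignedPermutation.

(** * The partial matching of vertices induced by an adapted structure on any graph *)

Section AdaptedPairing.
Local Open Scope ring_scope.
Variables (R : realType) (n : nat) (G : sgraph n).
Implicit Types (x y : nlie R G) (b c : 'I_n + edge G) (i j u v w t : 'I_n).

Lemma nbasis_inj : injective (@nbasis R n G).
Proof.
move=> b c /(congr1 (fun f : nlie R G => f b)) /eqP.
by rewrite !nbasisE eqxx; case: (b =P c) => // _; rewrite oner_eq0.
Qed.

Lemma nbasis_neqN b c : nbasis R b <> - nbasis R c.
Proof.
move=> /(congr1 (fun f : nlie R G => f b)) /eqP; rewrite ffunE !nbasisE eqxx.
case: (b =P c) => _; last by rewrite oppr0 oner_eq0.
by rewrite -subr_eq0 opprK -mulr2n pnatr_eq0.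
Qed.

(** A bracket of two vertices is nonzero only at the edge joining them, and an edge determines its
    two ends. *)
Lemma lie_basis_edge u v w t (e : edge G) :
  lie (nbasis R (inl u)) (nbasis R (inl v)) (inr e) != 0 ->
  lie (nbasis R (inl w)) (nbasis R (inl t)) (inr e) != 0 ->
  (w = u /\ t = v) \/ (w = v /\ t = u).
Proof.
have aux i j : lie (nbasis R (inl i)) (nbasis R (inl j)) (inr e) != 0 ->
    val e = (i, j) \/ val e = (j, i).
  rewrite lieE nbracket_inr !nbasisE; case: e => -[k l] /= _.
  have inlE p q : (inl p == inl q :> 'I_n + edge G) = (p == q) by [].
  rewrite !inlE -!natrM !mulnb.
  case: andP => [[/eqP-> /eqP->] _|_]; first by left.
  case: andP => [[/eqP-> /eqP->] _|_]; first by right.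
  by rewrite subrr eqxx.
move=> /aux uv /aux wt.
case: e {aux} uv wt => -[k l] _ /= [] [-> ->] [] [-> ->].
- by left.
- by right.
- by right.
- by left.
Qed.

Lemma lie_basis_neq0 u v : G u v ->
  exists e : edge G, lie (nbasis R (inl u)) (nbasis R (inl v)) (inr e) != 0.
Proof.
have lt_case i j (ij : (i < j)%N && G i j) :
    lie (nbasis R (inl i)) (nbasis R (inl j)) (inr (exist _ (i, j) ij)) != 0.
  by rewrite lie_adj nbasisE eqxx oner_eq0.
move=> uv; case: (ltngtP u v) => [ltuv|ltvu|/val_inj equv].
- have ij : (u < v)%N && G u v by rewrite ltuv.
  by exists (exist _ (u, v) ij); apply: lt_case.
- have ij : (v < u)%N && G v u by rewrite ltvu adj_sym.
  exists (exist _ (v, u) ij); have := lt_case _ _ ij.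
  rewrite !lieE !nbracket_inr -oppr_eq0 opprB mulrC [X in _ - X]mulrC.
  by rewrite mulrC [X in _ - X]mulrC.
- by rewrite equv adj_irr in uv.
Qed.

Lemma lieZl a x y : lie (a *: x) y = a *: lie x y :> nlie R G.
Proof.
apply/ffunP=> -[i|e]; rewrite !lieE !(nbracket_inl, nbracket_inr, ffunE);
  by rewrite /GRing.scale /=; ring.
Qed.

Lemma lieZr a x y : lie x (a *: y) = a *: lie x y :> nlie R G.
Proof.
apply/ffunP=> -[i|e]; rewrite !lieE !(nbracket_inl, nbracket_inr, ffunE);
  by rewrite /GRing.scale /=; ring.
Qed.

(** The sign is forgotten, and a vertex that [J] sends to an edge up to sign has no partner. *)
Definition paired (J : nlie R G -> nlie R G) u w : Prop :=
  J (nbasis R (inl u)) = nbasis R (inl w)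
  \/ J (nbasis R (inl u)) = - nbasis R (inl w).

Variable J : {linear nlie R G -> nlie R G}.
Hypothesis JK : forall x, J (J x) = - x.

Lemma paired_sym u w : paired J u w -> paired J w u.
Proof.
by case=> Ju; [right|left]; have := JK (nbasis R (inl u));
  rewrite Ju ?linearN => // /oppr_inj.
Qed.

Lemma paired_fun u w t : paired J u w -> paired J u t -> w = t.
Proof.
by rewrite /paired => -[->|->] [|] =>
  [/nbasis_inj[]|/nbasis_neqN|/esym/nbasis_neqN|/oppr_inj/nbasis_inj[]].
Qed.

Lemma paired_irr u : ~ paired J u u.
Proof.
by move=> [] Ju; have := JK (nbasis R (inl u)); rewrite ?(Ju, linearN) ?opprK;
  apply: nbasis_neqN.
Qed.

Hypothesis J_integrable : forall x y,
  lie x y + J (lie (J x) y + lie x (J y)) - lie (J x) (J y) = 0.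
Hypothesis J_adapted : forall x,
  in_VE x -> in_VE (J x) \/ in_VE (- J x).

Lemma adapted_basis b :
  exists c, J (nbasis R b) = nbasis R c \/ J (nbasis R b) = - nbasis R c.
Proof.
have bVE : in_VE (nbasis R b) by exists b.
have [[c Jb]|[c Jb]] := J_adapted bVE.
  by exists c; left.
by exists c; right; rewrite -Jb opprK.
Qed.

(** Edges are central, so an edge as image kills every bracket. The scalar [a] treats both signs at
    once by bilinearity. *)
Lemma adapted_vertex u :
  (exists w a, paired J u w /\ J (nbasis R (inl u)) = a *: nbasis R (inl w))
  \/ (forall y, lie (J (nbasis R (inl u))) y = 0
                /\ lie y (J (nbasis R (inl u))) = 0).
Proof.
have [[w|e] Ju] := adapted_basis (inl u); [left | right].
  by exists w; case: (Ju) => ->;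
    [exists 1; rewrite scale1r | exists (-1); rewrite scaleN1r].
by move=> y; case: Ju => ->; rewrite -?scaleN1r ?lieZl ?lieZr lie_edgel
  lie_edger ?scaler0.
Qed.

(* The term [Ju, Jv] cannot cancel [u, v] unless {Ju, Jv} = {u, v} up to sign,
   so otherwise J([Ju, v] + [u, Jv]) must be nonzero. *)
Lemma adapted_adj u v : G u v ->
  [\/ paired J u v, exists2 w, paired J u w & G w v
    | exists2 w, paired J v w & G u w].
Proof.
move=> /lie_basis_neq0[e uv].
have := J_integrable (nbasis R (inl u)) (nbasis R (inl v)).
(* Once both mixed brackets vanish, integrability equates [u, v] with [Ju, Jv], whose coordinate at
   [e] is then nonzero. *)
have uvE z : lie (nbasis R (inl u)) (nbasis R (inl v)) + J (0 + 0) - z = 0 ->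
    z (inr e) != 0.
  by rewrite addr0 linear0 addr0 => /eqP; rewrite subr_eq0 => /eqP <-.
have [[w [a [uw Ju]]]|Ju] := adapted_vertex u; last first.
  have [[t [b [vt Jv]]]|Jv] := adapted_vertex v; last first.
    by rewrite !(proj1 (Ju _)) (proj2 (Jv _)) => /uvE; rewrite ffunE eqxx.
  have [ut|/lie_nadj Nut] := boolP (G u t); first by constructor 3; exists t.
  rewrite !(proj1 (Ju _)) Jv lieZr Nut scaler0 => /uvE.
  by rewrite ffunE eqxx.
have [wv|/lie_nadj Nwv] := boolP (G w v); first by constructor 2; exists w.
have [[t [b [vt Jv]]]|Jv] := adapted_vertex v; last first.
  by rewrite !(proj2 (Jv _)) Ju lieZl Nwv scaler0 => /uvE; rewrite ffunE eqxx.
have [ut|/lie_nadj Nut] := boolP (G u t); first by constructor 3; exists t.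
rewrite Ju Jv !(lieZl, lieZr) Nwv Nut !scaler0 => /uvE; rewrite !ffunE => wt.
have{}wt : lie (nbasis R (inl w)) (nbasis R (inl t)) (inr e) != 0.
  by apply: contraNneq wt => ->; rewrite !scaler0.
(* Here {w, t} = {u, v}; since no vertex is its own partner, [w] is [v]. *)
have [[wu _]|[wv _]] := lie_basis_edge uv wt.
  by case: (paired_irr (u := u)); rewrite -{2}wu.
by constructor 1; rewrite -wv.
Qed.

End AdaptedPairing.

(** * Combinatorics of such a matching [P] on a cycle with at least five vertices *)

Section CyclePairing.
Variables (n : nat) (P : 'I_n -> 'I_n -> Prop).
Hypothesis n_gt4 : 4 < n.
Hypothesis P_sym : forall i j, P i j -> P j i.
Hypothesis P_fun : forall i j k, P i j -> P i k -> j = k.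
Hypothesis P_irr : forall i, ~ P i i.
Hypothesis P_adj : forall i j, cycle_graph n i j ->
  [\/ P i j, exists2 k, P i k & cycle_graph n k j
    | exists2 k, P j k & cycle_graph n i k].

Lemma val_iter_ordS k (i : 'I_n) : iter k (@ordS n) i = (i + k) %% n :> nat.
Proof.
elim: k => [|k IH] /=; first by rewrite addn0 modn_small.
by rewrite IH -addn1 modnDml -addnA addn1.
Qed.

Lemma iter_ordS_neq k (i : 'I_n) : 0 < k < n -> iter k (@ordS n) i <> i.
Proof.
case/andP=> k_gt0 k_ltn /(congr1 val)/= /eqP; rewrite val_iter_ordS.
rewrite -[X in _ == X](modn_small (ltn_ord i)) -[X in _ == X %% n]addn0.
by rewrite eqn_modDl mod0n modn_small // eqn0Ngt k_gt0.
Qed.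

Let ordS1 (i : 'I_n) : ordS i <> i.
Proof. by apply: (@iter_ordS_neq 1); apply: leq_trans n_gt4. Qed.
Let ordS2 (i : 'I_n) : ordS (ordS i) <> i.
Proof. by apply: (@iter_ordS_neq 2); apply: leq_trans n_gt4. Qed.
Let ordS3 (i : 'I_n) : ordS (ordS (ordS i)) <> i.
Proof. by apply: (@iter_ordS_neq 3); apply: leq_trans n_gt4. Qed.
(** The only one of the four that needs the full bound [4 < n]: on the 4-cycle j + 4 is j, and
    pairing opposite vertices is consistent. *)
Let ordS4 (i : 'I_n) : ordS (ordS (ordS (ordS i))) <> i.
Proof. by apply: (@iter_ordS_neq 4). Qed.

(** This is [P_adj] on the edge {j+1, j+2}: the neighbours of j+2 are j+1 and j+3, those of j+1 are
    j and j+2, and [P_irr] discards one of each. *)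
Lemma pairing_step j :
  [\/ P (ordS j) (ordS (ordS j)), P (ordS j) (ordS (ordS (ordS j)))
    | P j (ordS (ordS j))].
Proof.
have adjS (i : 'I_n) : cycle_graph n i (ordS i).
  by rewrite /= /cycle_adj /= eqxx andbT eq_sym; apply/eqP/ordS1.
have [|[k Pk]|[k Pk]] := P_adj (adjS (ordS j)); first by constructor 1.
- case/andP=> _ /orP[] /eqP; last by move=> kE; constructor 2; rewrite -kE.
  by move=> /ordS_inj kE; move: Pk; rewrite kE => /P_irr.
- case/andP=> _ /orP[] /eqP.
    by move=> kE; move: Pk; rewrite kE => /P_irr.
  by move=> /ordS_inj jk; move: Pk; rewrite -jk => /P_sym; constructor 3.
Qed.

Lemma pairing_not_succ j : ~ P (ordS j) (ordS (ordS j)).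
Proof.
move=> Pj; case: (pairing_step (ordS j)) => Pj'.
- by have /esym/ordS2 := P_fun (P_sym Pj) Pj'.
- by have /esym/ordS3 := P_fun (P_sym Pj) Pj'.
- by have /esym/ordS1 := P_fun Pj Pj'.
Qed.

Lemma pairing_not_alternate j :
  P j (ordS (ordS j)) -> ~ P (ordS (ordS j)) (ordS (ordS (ordS (ordS j)))).
Proof. by move=> /P_sym Pj /(P_fun Pj)/esym/ordS4. Qed.

Lemma no_pairing : False.
Proof.
have around j : P (ordS j) (ordS (ordS (ordS j))) \/ P j (ordS (ordS j)).
  by case: (pairing_step j) => [/pairing_not_succ||]; [|left|right].
(* The pair {j, j+2} excludes {j+2, j+4}, so [around] at j+1 leaves {j+1, j+3}. This excludes {j+3,
   j+5}, and [around] at j+2 has no option left. *)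
have absurd j : ~ P j (ordS (ordS j)).
  move=> Pj; case: (around (ordS j)) => [/(pairing_not_alternate Pj)//|Pj1].
  case: (around (ordS (ordS j))) => [|/(pairing_not_alternate Pj)//].
  exact: pairing_not_alternate.
have j := Ordinal (ltn_trans (isT : 0 < 4) n_gt4).
by case: (around j) => /absurd.
Qed.

End CyclePairing.

Lemma cycle_not_adapted (R : realType) n :
  4 < n -> ~ admits_adapted_complex_structure R (cycle_graph n).
Proof.
move=> n_gt4 [J [[JK J_int] J_ad]].
apply: (@no_pairing n (paired J) n_gt4).
- exact: paired_sym.
- exact: paired_fun.
- exact: paired_irr.
- exact: adapted_adj.
Qed.

(** * Explicit structures on the 3-cycle and the 4-cycle *)

Section SmallCycles.
Local Open Scope ring_scope.
Variable R : realType.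

Let nlieE := (lieE, nbracket_inl, nbracket_inr, signed_permE, ffunE).

(* The entries of d are chosen so that J v_0 = v_1, J v_2 = e_{0,1} and
   J e_{0,2} = e_{1,2}. *)
Lemma cycle3_adapted : admits_adapted_complex_structure R (cycle_graph 3).
Proof.
pose v k (lt_k3 : (k < 3)%N) := Ordinal lt_k3.
pose e01 : edge (cycle_graph 3) := exist _ (v 0 isT, v 1 isT) isT.
pose e02 : edge (cycle_graph 3) := exist _ (v 0 isT, v 2 isT) isT.
pose e12 : edge (cycle_graph 3) := exist _ (v 1 isT, v 2 isT) isT.
(* Pairing v_0 with v_1 leaves v_2 to be paired with an edge. With J v_2 = e_{0,1} central,
   integrability on v_0, v_2 reads e_{0,2} + J e_{1,2} = 0, which dictates the last pair. *)
pose s (c : 'I_3 + edge (cycle_graph 3)) : 'I_3 + edge (cycle_graph 3) :=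
  match c with
  | inl i => match val i with
             | 0 => inl (v 1 isT) | 1 => inl (v 0 isT) | _ => inr e01
             end
  | inr e => match val (val e).1, val (val e).2 with
             | 0, 1 => inl (v 2 isT) | 0, _ => inr e12 | _, _ => inr e02
             end
  end.
pose d (c : 'I_3 + edge (cycle_graph 3)) : bool :=
  match c with
  | inl i => (val i != 1)%N
  | inr e => ((val (val e).1 == 0) && (val (val e).2 == 2))%N
  end.
(* With the bound proofs normalised to [isT], [s] and [d] compute on each basis element, and
   integrability becomes one polynomial identity per coordinate. *)
have cases (Q : 'I_3 + edge (cycle_graph 3) -> Prop) :
    Q (inl (v 0 isT)) -> Q (inl (v 1 isT)) -> Q (inl (v 2 isT)) ->
    Q (inr e01) -> Q (inr e02) -> Q (inr e12) -> forall c, Q c.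
  move=> q0 q1 q2 q01 q02 q12 [[[|[|[|//]]] lt_i]|e].
  1-3: by rewrite (bool_irrelevance lt_i isT).
  have: [\/ e = e01, e = e02 | e = e12]; last by case=> ->.
  case: e => -[[[|[|[|//]]] lt_i] [[|[|[|//]]] lt_j]] ij //.
  - by constructor 1; apply/val_inj/eqP.
  - by constructor 2; apply/val_inj/eqP.
  - by constructor 3; apply/val_inj/eqP.
apply: (@signed_perm_adapted R 3 _ d s).
- by apply: cases.
- by apply: cases.
move=> x y; apply/ffunP; apply: cases; rewrite !nlieE /=; ring.
Qed.

(* The entries of d are chosen so that J v_0 = v_2, J v_1 = v_3,
   J e_{1,2} = e_{0,1} and J e_{0,3} = e_{2,3}. *)
Lemma cycle4_adapted : admits_adapted_complex_structure R (cycle_graph 4).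
Proof.
pose v k (lt_k4 : (k < 4)%N) := Ordinal lt_k4.
pose e01 : edge (cycle_graph 4) := exist _ (v 0 isT, v 1 isT) isT.
pose e12 : edge (cycle_graph 4) := exist _ (v 1 isT, v 2 isT) isT.
pose e23 : edge (cycle_graph 4) := exist _ (v 2 isT, v 3 isT) isT.
pose e03 : edge (cycle_graph 4) := exist _ (v 0 isT, v 3 isT) isT.
(* Opposite vertices are paired. Integrability on v_0, v_1 then reads e_{0,1} - e_{2,3} = J (e_{1,2}
   - e_{0,3}), which suggests the pairs of edges. *)
pose s (c : 'I_4 + edge (cycle_graph 4)) : 'I_4 + edge (cycle_graph 4) :=
  match c with
  | inl i => match val i with
             | 0 => inl (v 2 isT) | 1 => inl (v 3 isT)
             | 2 => inl (v 0 isT) | _ => inl (v 1 isT)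
             end
  | inr e => match val (val e).1, val (val e).2 with
             | 0, 1 => inr e12 | 0, _ => inr e23
             | 1, _ => inr e01 | _, _ => inr e03
             end
  end.
pose d (c : 'I_4 + edge (cycle_graph 4)) : bool :=
  match c with
  | inl i => (val i < 2)%N
  | inr e => match val (val e).1, val (val e).2 with
             | 0, 3 | 1, _ => true | _, _ => false
             end
  end.
have cases (Q : 'I_4 + edge (cycle_graph 4) -> Prop) :
    Q (inl (v 0 isT)) -> Q (inl (v 1 isT)) ->
    Q (inl (v 2 isT)) -> Q (inl (v 3 isT)) ->
    Q (inr e01) -> Q (inr e12) -> Q (inr e23) -> Q (inr e03) -> forall c, Q c.
  move=> q0 q1 q2 q3 q01 q12 q23 q03 [[[|[|[|[|//]]]] lt_i]|e].
  1-4: by rewrite (bool_irrelevance lt_i isT).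
  have: [\/ e = e01, e = e12, e = e23 | e = e03]; last by case=> ->.
  case: e => -[[[|[|[|[|//]]]] lt_i] [[|[|[|[|//]]]] lt_j]] ij //.
  - by constructor 1; apply/val_inj/eqP.
  - by constructor 4; apply/val_inj/eqP.
  - by constructor 2; apply/val_inj/eqP.
  - by constructor 3; apply/val_inj/eqP.
apply: (@signed_perm_adapted R 4 _ d s).
- by apply: cases.
- by apply: cases.
move=> x y; apply/ffunP; apply: cases; rewrite !nlieE /=; ring.
Qed.

End SmallCycles.

Theorem corollary5p18 (R : realType) (n : nat) (hn : 3 <= n) :
  admits_adapted_complex_structure R (cycle_graph n) <-> n = 3 \/ n = 4.
Proof.
split=> [Jn|[->|->]]; [|exact: cycle3_adapted|exact: cycle4_adapted].
case: (ltnP 4 n) => [/cycle_not_adapted/(_ Jn)//|].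
by case: n hn {Jn} => [|[|[|[|[|]]]]] //; [left | right].
Qed.
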